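(* Let $\lambda>0$, let $k$ be a positive integer, and let $A,W\in\mathbb{R}^{n\times d}$ and $\varepsilon<0.1$ be such that $\mathrm{rank}(W)=r$, and let $s=\max_{i,j}\{\mathrm{sd}_\lambda(V^*D_{W_{i,:}}),\ \mathrm{sd}_\lambda(D_{W_{:,j}}U^* )\}<k$, where $U^*,V^*$ are minimizers of the rank-$k$ problem. For a positive integer $m$ let $$\mathrm{OPT}(m)=\min_{U\in\mathbb{R}^{n\times m},\,V\in\mathbb{R}^{m\times d}}\|W\circ(UV-A)\|_F^2+\lambda\|U\|_F^2+\lambda\|V\|_F^2.$$ Then $\mathrm{OPT}\big(O(r(s+\log(1/\varepsilon))/\varepsilon)\big)\le(1+\varepsilon)\mathrm{OPT}(k)$, i.e., there is an absolute constant $C$ such that for $m=\lceil C\,r(s+\log(1/\varepsilon))/\varepsilon\rceil$ one has $\mathrm{OPT}(m)\le(1+\varepsilon)\mathrm{OPT}(k)$.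
   Context: $\circ$ is the entrywise product and $\|\cdot\|_F$ the Frobenius norm. $U^*\in\mathbb{R}^{n\times k},V^*\in\mathbb{R}^{k\times d}$ minimize $\|W\circ(UV-A)\|_F^2+\lambda\|U\|_F^2+\lambda\|V\|_F^2$. For a matrix $M$ with singular values $\sigma_i$, $\mathrm{sd}_\lambda(M)=\sum_i 1/(1+\lambda/\sigma_i^2)$ (sum over nonzero singular values). $D_{W_{i,:}}$ is the $d\times d$ diagonal matrix with the $i$-th row of $W$ on its diagonal, and $D_{W_{:,j}}$ is the $n\times n$ diagonal matrix with the $j$-th column of $W$ on its diagonal. *)

(* Defs.v *)
From HB Require Import structures.
From mathcomp Require Import all_boot all_order all_algebra.
From mathcomp Require Import spectral complex.
From mathcomp Require Import all_classical all_reals all_analysis.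

Set Implicit Arguments.
Unset Strict Implicit.
Unset Printing Implicit Defensive.

Import Order.TTheory GRing.Theory Num.Theory.
Import numFieldNormedType.Exports.

Local Open Scope classical_set_scope.
Local Open Scope sesquilinear_scope.
Local Open Scope ring_scope.

Definition hadamard (R : realType) (m n : nat) (A B : 'M[R]_(m, n)) :
    'M[R]_(m, n) :=
  map2_mx *%R A B.

Definition frobenius (R : realType) (m n : nat) (M : 'M[R]_(m, n)) : R :=
  Num.sqrt (\sum_i \sum_j M i j ^+ 2).

(* [spectral_diag] lists the eigenvalues, with multiplicity, of a normal matrix
   over a closed field, so the Gram matrix is viewed over R[i]; its eigenvalues
   are nonnegative reals. The list has m entries, hence possibly more zeros than
   there are singular values, see [char_poly_gram]. *)
Definition singular_value (R : realType) (m n : nat) (M : 'M[R]_(m, n))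
    (i : 'I_m) : R :=
  Num.sqrt (complex.Re
    (spectral_diag (map_mx (real_complex R) (M *m M^T)) 0 i)).

Definition sd (R : realType) (lam : R) (m n : nat) (M : 'M[R]_(m, n)) : R :=
  \sum_(i < m | singular_value M i != 0)
    1 / (1 + lam / singular_value M i ^+ 2).

Definition loss (R : realType) (n d : nat) (lam : R) (A W : 'M[R]_(n, d))
    (m : nat) (U : 'M[R]_(n, m)) (V : 'M[R]_(m, d)) : R :=
  frobenius (hadamard W (U *m V - A)) ^+ 2
    + lam * frobenius U ^+ 2 + lam * frobenius V ^+ 2.

Definition minimizer (R : realType) (n d : nat) (lam : R) (A W : 'M[R]_(n, d))
    (m : nat) (U : 'M[R]_(n, m)) (V : 'M[R]_(m, d)) : Prop :=
  forall (U' : 'M[R]_(n, m)) (V' : 'M[R]_(m, d)),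
    loss lam A W U V <= loss lam A W U' V'.

(* The infimum is attained when [0 < lam], see [OPT_attained]. *)
Definition OPT (R : realType) (n d : nat) (lam : R) (A W : 'M[R]_(n, d))
    (m : nat) : R :=
  inf [set loss lam A W UV.1 UV.2
      | UV in [set: 'M[R]_(n, m) * 'M[R]_(m, d)]].

(* [sd] is nonnegative, so 0 is a neutral starting value. *)
Definition max_sd (R : realType) (n d k : nat) (lam : R) (W : 'M[R]_(n, d))
    (U : 'M[R]_(n, k)) (V : 'M[R]_(k, d)) : R :=
  Num.max
    (\big[Num.max/0]_(i < n) sd lam (V *m diag_mx (row i W)))
    (\big[Num.max/0]_(j < d) sd lam (diag_mx (col j W)^T *m U)).

Lemma frobenius_sqr (R : realType) (m n : nat) (M : 'M[R]_(m, n)) :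
  frobenius M ^+ 2 = \sum_i \sum_j M i j ^+ 2.
Proof.
rewrite sqr_sqrtr//; apply: sumr_ge0 => i _; apply: sumr_ge0 => j _.
exact: sqr_ge0.
Qed.

Lemma frobenius_ge (R : realType) (m n : nat) (M : 'M[R]_(m, n)) i j :
  M i j ^+ 2 <= frobenius M ^+ 2.
Proof.
rewrite frobenius_sqr (bigD1 i)//= (bigD1 j)//= -addrA lerDl.
apply: addr_ge0; first by apply: sumr_ge0 => ? _; exact: sqr_ge0.
by apply: sumr_ge0 => ? _; apply: sumr_ge0 => ? _; exact: sqr_ge0.
Qed.

Lemma gram_complex (R : realType) (m n : nat) (M : 'M[R]_(m, n))
    (N := map_mx (real_complex R) M) :
  map_mx (real_complex R) (M *m M^T) = N *m N ^t*.
Proof.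
have -> : N ^t* = N^T.
  by apply/matrixP => a b; rewrite !mxE conj_Creal// complex_real.
by rewrite map_mxM /= map_trmx.
Qed.

Lemma gram_normal (R : realType) (m n : nat) (M : 'M[R]_(m, n)) :
  map_mx (real_complex R) (M *m M^T) \is normalmx.
Proof.
by apply/normalmxP; rewrite gram_complex !(trmx_mul, map_mxM)/= trmxCK.
Qed.

Lemma gram_spectral (R : realType) (m n : nat) (M : 'M[R]_(m, n)) (i : 'I_m) :
  spectral_diag (map_mx (real_complex R) (M *m M^T)) 0 i =
  real_complex R (singular_value M i ^+ 2).
Proof.
set G := map_mx _ _; set N := map_mx (real_complex R) M.
have GE : G = N *m N ^t* by exact: gram_complex.
have Gn : G \is normalmx by exact: gram_normal.
have GS := orthomx_spectralP Gn; set P := spectralmx G in GS.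
have Pu : P \is unitarymx by exact: spectral_unitarymx.
have DE : diag_mx (spectral_diag G) = (P *m N) *m (P *m N) ^t*.
  rewrite trmx_mul map_mxM/= -mulmxA [N *m (_ *m _)]mulmxA -GE.
  rewrite {2}GS invmx_unitary// !mulmxA (unitarymxP Pu) mul1mx.
  by rewrite -mulmxA (unitarymxP Pu) mulmx1.
have : 0 <= spectral_diag G 0 i.
  have -> : spectral_diag G 0 i = diag_mx (spectral_diag G) i i.
    by rewrite mxE eqxx mulr1n.
  rewrite DE mxE; apply: sumr_ge0 => j _; rewrite !mxE; exact: mul_conjC_ge0.
rewrite /singular_value -/G; case: (spectral_diag G 0 i) => a b.
rewrite lecE /= => /andP[/eqP-> a0]; by rewrite sqr_sqrtr.
Qed.

(* The squared singular values are the eigenvalues of the Gram matrix, counted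
   with multiplicity. *)
Lemma char_poly_gram (R : realType) (m n : nat) (M : 'M[R]_(m, n)) :
  char_poly (M *m M^T) = \prod_i ('X - (singular_value M i ^+ 2)%:P).
Proof.
apply: (@map_poly_inj _ _ (real_complex R)).
rewrite map_char_poly rmorph_prod/=; set G := map_mx _ _.
have Gn : G \is normalmx by exact: gram_normal.
have GS := orthomx_spectralP Gn.
have cE : map_mx polyC (invmx (spectralmx G)) *m char_poly_mx (diag_mx (spectral_diag G))
   *m map_mx polyC (spectralmx G) = char_poly_mx G.
  rewrite [in RHS]GS /char_poly_mx mulmxBr mulmxBl !map_mxM/=; congr (_ - _).
  by rewrite scalar_mxC -mulmxA -map_mxM mulVmx ?spectral_unit// map_mx1 mulmx1.
rewrite /char_poly -cE !det_mulmx mulrAC -det_mulmx -map_mxM mulVmx ?spectral_unit//.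
rewrite map_mx1 det1 mul1r -/(char_poly _) char_poly_trig ?diag_mx_is_trig//.
apply: eq_bigr => i _; rewrite mxE eqxx mulr1n gram_spectral.
by rewrite rmorphB/= map_polyX map_polyC.
Qed.

Lemma OPT_attained (R : realType) (n d : nat) (lam : R) (A W : 'M[R]_(n, d))
    (m : nat) : 0 < lam ->
  exists U : 'M[R]_(n, m), exists V : 'M[R]_(m, d),
    minimizer lam A W U V /\ OPT lam A W m = loss lam A W U V.
Proof.
move=> lam0.
suff [U [V UV]] : exists U : 'M[R]_(n, m), exists V : 'M[R]_(m, d),
    minimizer lam A W U V.
  exists U, V; split=> //; apply/eqP; rewrite eq_le; apply/andP; split.
    apply: ge_inf; last by exists (U, V).
    by exists (loss lam A W U V) => _ [[U' V'] _ <-]; exact: UV.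
  apply: lb_le_inf; first by exists (loss lam A W U V); exists (U, V).
  by move=> _ [[U' V'] _ <-]; exact: UV.
pose u (x : 'rV[R]_(n * m + m * d)) : 'M[R]_(n, m) := vec_mx (lsubmx x).
pose v (x : 'rV[R]_(n * m + m * d)) : 'M[R]_(m, d) := vec_mx (rsubmx x).
pose f x := loss lam A W (u x) (v x).
have cc (k : nat) (j : 'I_k) : continuous (fun x : 'rV[R]_k => x 0 j).
  exact: coord_continuous.
have cu i j : continuous (fun x => u x i j).
  by move=> x; under eq_fun do rewrite /u !mxE; exact: cc.
have cv i j : continuous (fun x => v x i j).
  by move=> x; under eq_fun do rewrite /v !mxE; exact: cc.
have cM (T : topologicalType) (F G : T -> R) : continuous F -> continuous G ->
    continuous (fun x => F x * G x).
  by move=> cF cG x; apply: cvgM; [exact: cF|exact: cG].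
have cD (T : topologicalType) (F G : T -> R) : continuous F -> continuous G ->
    continuous (fun x => F x + G x).
  by move=> cF cG x; apply: cvgD; [exact: cF|exact: cG].
have cst (T : topologicalType) (a : R) : continuous (fun _ : T => a).
  by move=> x; exact: cvg_cst.
have csum (T : topologicalType) (I : finType) (F : I -> T -> R) :
    (forall i, continuous (F i)) -> continuous (fun x => \sum_i F i x).
  by move=> cF; apply: continuous_big => //; exact: add_continuous.
have cF p q (M : 'rV[R]_(n * m + m * d) -> 'M[R]_(p, q)) :
    (forall i j, continuous (fun x => M x i j)) ->
    continuous (fun x => frobenius (M x) ^+ 2).
  move=> cMx; under eq_fun do rewrite frobenius_sqr.
  apply: (csum) => i; apply: (csum) => j.
  by under eq_fun do rewrite expr2; apply: (cM).
have cf : continuous f.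
  rewrite /f /loss; apply: (cD); first apply: (cD).
  - apply: (cF) => i j; under eq_fun do rewrite !mxE.
    apply: (cM); first exact: cst.
    apply: (cD); last exact: cst.
    by apply: (csum) => k; apply: (cM).
  - by apply: (cM); [exact: cst|exact: cF].
  - by apply: (cM); [exact: cst|exact: cF].
pose S := [set x | f x <= f 0].
have cS : compact S.
  apply: bounded_closed_compact; last first.
    have /continuous_closedP := cf.
    by move/(_ _ (@closed_le _ (f 0))).
  exists (f 0 / lam + 1); split; first exact: num_real.
  move=> B fB x Sx; have fr0 p q (M : 'M[R]_(p, q)) : 0 <= frobenius M ^+ 2.
    exact: sqr_ge0.
  have B0 : 0 <= B.
    apply/ltW/(le_lt_trans _ fB)/addr_ge0 => //; apply: divr_ge0; last exact: ltW.
    by rewrite /f /loss !addr_ge0// mulr_ge0// ltW.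
  have key y : lam * y ^+ 2 <= f x -> `|y| <= B.
    move=> yx; have {yx} : y ^+ 2 <= f 0 / lam.
      by rewrite ler_pdivlMr// mulrC (le_trans yx).
    move=> yx; have [|y1] := leP `|y| 1.
      move=> y1; apply/(le_trans y1)/ltW/(le_lt_trans _ fB).
      by rewrite lerDr (le_trans _ yx)// sqr_ge0.
    apply/ltW/(le_lt_trans _ fB); apply: ler_wpDr => //; apply: le_trans yx.
    by rewrite -real_normK ?num_real// expr2 ler_peMl// ltW.
  rewrite /Num.Def.normr /= mx_normrE; apply: bigmax_le => //= -[i j] _ /=.
  apply: (key); rewrite ord1; case: (fintype.splitP j) => k jk.
    have -> : j = lshift _ k by exact: val_inj.
    have -> : x 0 (lshift _ k) = lsubmx x 0 k by rewrite mxE.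
    rewrite -[lsubmx x]vec_mxK -/(u x); case/mxvec_indexP: k {jk} => a b.
    rewrite mxvecE /f /loss -addrA addrCA.
    apply: ler_wpDr; first by rewrite addr_ge0// mulr_ge0// ltW.
    by rewrite ler_pM2l// frobenius_ge.
  have -> : j = rshift _ k by exact: val_inj.
  have -> : x 0 (rshift _ k) = rsubmx x 0 k by rewrite mxE.
  rewrite -[rsubmx x]vec_mxK -/(v x); case/mxvec_indexP: k {jk} => a b.
  rewrite mxvecE /f /loss addrC.
  apply: ler_wpDr; first by rewrite addr_ge0// mulr_ge0// ltW.
  by rewrite ler_pM2l// frobenius_ge.
have S0 : S !=set0 by exists 0; rewrite /S /=.
have [c cS' cmin] := EVT_min_rV S0 cS (continuous_subspaceT cf).
exists (u c), (v c) => U' V'.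
pose x := row_mx (mxvec U') (mxvec V').
have -> : loss lam A W U' V' = f x.
  by rewrite /f /u /v row_mxKl row_mxKr !mxvecK.
rewrite -/(f c); have [fx|fx] := leP (f x) (f 0); first by apply: cmin; rewrite inE.
apply: le_trans (ltW fx); apply: cmin; by rewrite inE /S /=.
Qed.

(* Main.v *)
(** Let [U, V] be the minimizers and [B_i = V D_{W_{i,:}}].  No random sketch is
    needed.  Among all families of [2r] rows of [W], one of maximal Gram determinant expresses every row of
    [W] with coefficients of square sum at most [1]; hence by Cauchy-Schwarz
    every [B_i B_i^T] lies below [Psi], the sum of the [2r] chosen
    [B_l B_l^T].  The function [M |-> tr (M (M + lambda)^-1)] is subadditive, so
    it is at most [2rs] at [Psi], and thus at most [2rs(1 + 1/eps)] eigenvalues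
    of [Psi] exceed [eps lambda].  Project [U] and [V] onto the corresponding
    eigenspace, with complementary projection [P]: stationarity of the minimizer
    makes the loss increase by exactly [||W o (U P V)||_F^2], which is at most
    [tr (U P Psi P U^T) <= eps lambda ||U||_F^2 <= eps OPT(k)]. *)

Require Import Defs.
From mathcomp Require Import all_boot all_order all_algebra.
From mathcomp Require Import spectral complex.
From mathcomp Require Import all_classical all_reals all_analysis.
From mathcomp Require Import ring lra.
Import Order.TTheory GRing.Theory Num.Theory.
Local Open Scope sesquilinear_scope.
Local Open Scope ring_scope.

Set Implicit Arguments.
Unset Strict Implicit.
Unset Printing Implicit Defensive.

(** * The spectral theorem for real symmetric matrices *)

Lemma mul_rV_trE (R : realType) n (x y : 'rV[R]_n) :
  (x *m y^T) 0 0 = \sum_i x 0 i * y 0 i.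
Proof. by rewrite mxE; apply: eq_bigr => i _; rewrite mxE. Qed.

Lemma mul_rV_tr_gt0 (R : realType) n (x : 'rV[R]_n) :
  x != 0 -> 0 < (x *m x^T) 0 0.
Proof.
move=> x0; rewrite mul_rV_trE lt_neqAle sumr_ge0 ?andbT; last first.
  by move=> i _; rewrite -expr2 sqr_ge0.
apply: contraNneq x0 => /esym /eqP.
rewrite psumr_eq0 => [/allP xx|i _]; last by rewrite -expr2 sqr_ge0.
apply/eqP/rowP => i; rewrite mxE; apply/eqP.
by have := xx i (mem_index_enum _); rewrite mulf_eq0 orbb.
Qed.

(** Over [R[i]] an eigenvalue [a] with eigenvector [v] exists. Since [AC] is self-adjoint,
    [v AC v^*] and [v v^*] are both real, so [a] is real, and it is a root of the real
    characteristic polynomial. *)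
Lemma symmetric_eigenvalue (R : realType) n (A : 'M[R]_n.+1) :
  A^T = A -> exists b, eigenvalue A b.
Proof.
move=> AT; pose AC := map_mx (real_complex R) A.
have [a aAC] := eigenvalue_closed AC (ltn0Sn n).
have [v vA v0] := eigenvalueP aAC.
have vv0 : (v *m v ^t*) 0 0 != 0.
  apply: contra_neq v0 => /eqP; rewrite mxE.
  rewrite psumr_eq0; last by move=> i _; rewrite !mxE mul_conjC_ge0.
  move=> /allP xx.
  apply/rowP => i; rewrite mxE; apply/eqP.
  by have := xx i (mem_index_enum _); rewrite !mxE mul_conjC_eq0.
have ACc : AC ^t* = AC.
  by apply/matrixP => i j; rewrite !mxE conj_Creal ?complex_real// -[in RHS]AT mxE.
have real11 (M : 'M[R[i]]_1) : M ^t* = M -> M 0 0 \is Num.real.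
  by move=> /matrixP/(_ 0 0); rewrite !mxE => h; apply/CrealP.
have aR : a \is Num.real.
  have /matrixP/(_ 0 0) : v *m AC *m v ^t* = a *: (v *m v ^t*).
    by rewrite vA scalemxAl.
  rewrite [in RHS]mxE => e.
  rewrite -[a](mulfK vv0) -e; apply: rpred_div; apply: real11.
    by rewrite !trmx_mul !map_mxM /= trmxCK ACc mulmxA.
  by rewrite !trmx_mul !map_mxM /= trmxCK.
exists (complex.Re a); move: aAC; rewrite !eigenvalue_root_char.
by rewrite -map_char_poly -[a in root _ a](RRe_real aR) fmorph_root.
Qed.

(** Householder reflection: unless [v] is already the first basis vector [e], the reflection along
    [w = v - e] exchanges the unit vectors [e] and [v]. *)
Lemma reflection_to_row (R : realType) n (v : 'rV[R]_n.+1) :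
  v *m v^T = 1%:M -> exists H : 'M[R]_n.+1, H *m H^T = 1%:M /\ row 0 H = v.
Proof.
move=> vv; pose e : 'rV[R]_n.+1 := delta_mx 0 0; pose w := v - e.
have ee : e *m e^T = 1%:M.
  by rewrite /e trmx_delta mul_delta_mx; apply/matrixP => i j; rewrite !mxE !ord1.
have ve : v *m e^T = e *m v^T.
  by apply: trmx_inj; rewrite !trmx_mul !trmxK [LHS]mx11_scalar [RHS]mx11_scalar
    !mul_rV_trE; congr _%:M; apply: eq_bigr => i _; rewrite mulrC.
have [w0|w0] := eqVneq w 0.
  exists 1%:M; rewrite trmx1 mulmx1; split => //.
  by rewrite row1 -/e; apply/esym/eqP; rewrite -subr_eq0 -/w w0.
have q0 := mul_rV_tr_gt0 w0; set q := (w *m w^T) 0 0 in q0.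
have wwE : w *m w^T = q%:M by rewrite [LHS]mx11_scalar.
(* This is where equality of the lengths of [v] and [e] enters; it makes the reflection send [e] to
   [e + w = v]. *)
have ew : 2 *: (e *m w^T) = - (w *m w^T).
  rewrite /w [(v - e)^T]raddfB /= !mulmxBl !mulmxBr ee vv ve; set m2 := _ *m _.
  by rewrite scaler_nat mulr2n !opprB.
have -> : v = e + w by rewrite addrC subrK.
move: w w0 q q0 wwE ew => {}w w0 q q0 wwE ew.
exists (1%:M - (2 / q) *: (w^T *m w)); split.
  have -> : (1%:M - (2 / q) *: (w^T *m w))^T = 1%:M - (2 / q) *: (w^T *m w).
    by apply/matrixP => i j; rewrite !mxE eq_sym !big_ord1 !mxE [w 0 j * _]mulrC.
  rewrite mulmxBl mulmxBr mulmx1 mul1mx.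
  rewrite mulmxBr mulmx1 -scalemxAl -scalemxAr mulmxA -[w^T *m w *m w^T]mulmxA.
  rewrite wwE mul_mx_scalar -scalemxAl !scalerA.
  rewrite -addrA; set k1 := _ *: _; set k2 := _ *: _.
  suff -> : k2 = k1 + k1 by rewrite opprB addrK addNr addr0.
  rewrite -scalerDl; congr (_ *: _); field; exact: lt0r_neq0.
rewrite rowE mulmxBr mulmx1 -scalemxAr mulmxA -/e mulrC -scalerA scalemxAl ew wwE.
by rewrite mulNmx mul_scalar_mx scalerN scalerA mulVf ?gt_eqF// scale1r opprK.
Qed.

(** Deflation: a reflection whose first row is a unit eigenvector conjugates [A] to a matrix with
    first row [b e_0]. By symmetry the first column is the same, and the induction applies to the
    lower right block. *)
Lemma symmetric_spectral (R : realType) n (A : 'M[R]_n) : A^T = A ->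
  exists O : 'M[R]_n, exists mu : 'rV[R]_n,
    O *m O^T = 1%:M /\ A = O^T *m diag_mx mu *m O.
Proof.
elim: n => [|n IHn] in A * => AT.
  by exists 1%:M, 0; split; [rewrite trmx1 mulmx1|rewrite [LHS]flatmx0 [RHS]flatmx0].
have [b /eigenvalueP[v vA v0]] := symmetric_eigenvalue AT.
have q0 := mul_rV_tr_gt0 v0; set q := (v *m v^T) 0 0 in q0.
pose u := (Num.sqrt q)^-1 *: v.
have uu : u *m u^T = 1%:M.
  rewrite linearZ /= -scalemxAr -scalemxAl [v *m v^T]mx11_scalar -/q scalerA.
  by rewrite -expr2 exprVn sqr_sqrtr ?ltW// scale_scalar_mx mulVf ?gt_eqF.
have uA : u *m A = b *: u by rewrite -scalemxAl vA !scalerA mulrC.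
have [H [HH Hu]] := reflection_to_row uu.
have HtH : H^T *m H = 1%:M by apply: mulmx1C.
pose B : 'M[R]_(1 + n) := H *m A *m H^T.
have BT : B^T = B by rewrite !trmx_mul trmxK AT mulmxA.
have rB : row 0 B = b *: delta_mx 0 0.
  by rewrite /B !row_mul Hu uA -scalemxAl -Hu rowE -mulmxA HH mulmx1.
have BA : H^T *m (B *m H) = A.
  by rewrite /B -!mulmxA HtH mulmx1 mulmxA HtH mul1mx.
clearbody B.
have B0 j : B (lshift n 0) j = b * (j == lshift n 0)%:R.
  have l0 : lshift n 0 = 0 :> 'I_(1 + n) by apply/val_inj.
  by have /rowP/(_ j) := rB; rewrite !mxE l0.
have ur0 : ursubmx B = 0.
  by apply/rowP => j; rewrite !mxE B0 eq_rlshift mulr0.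
have BE : B = block_mx b%:M 0 0 (drsubmx B).
  rewrite -[LHS]submxK ur0; congr block_mx.
    by rewrite [LHS]mx11_scalar !mxE B0 eqxx mulr1.
  by apply: trmx_inj; rewrite trmx_dlsub BT ur0 trmx0.
have [|O' [mu' [OO' BE']]] := IHn (drsubmx B).
  by rewrite -{2}BT trmx_drsub.
pose K : 'M[R]_(1 + n) := block_mx (1%:M : 'M[R]_1) 0 0 O'.
pose D : 'rV[R]_(1 + n) := row_mx (b%:M : 'M[R]_1) mu'.
have KK : K *m K^T = 1%:M.
  rewrite /K tr_block_mx mulmx_block !trmx1 !trmx0 !mul0mx !mulmx0 !mulmx1 OO'.
  by rewrite !addr0 !add0r -scalar_mx_block.
have KB : B = K^T *m diag_mx D *m K.
  rewrite BE BE' /K /D diag_mx_row tr_block_mx !mulmx_block !trmx1 !trmx0.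
  rewrite !mul0mx !mulmx0 ?mul1mx ?mulmx1 ?addr0 ?add0r ?mulmx0.
  rewrite mul0mx; congr block_mx.
  by apply/matrixP => i j; rewrite !ord1 !mxE eqxx !mulr1n.
exists ((K : 'M[R]_n.+1) *m H), (D : 'rV[R]_n.+1); split.
  by rewrite trmx_mul mulmxA -[_ *m H *m H^T]mulmxA HH mulmx1.
by rewrite -[LHS]BA [B in LHS]KB trmx_mul !mulmxA.
Qed.

(** * Positive semidefinite matrices and [sd] as a trace *)

Definition psd (R : realType) n (A : 'M[R]_n) : Prop :=
  forall x : 'rV[R]_n, 0 <= (x *m A *m x^T) 0 0.

Lemma psd_shift_unit (R : realType) n (A : 'M[R]_n) (lam : R) :
  0 < lam -> psd A -> A + lam%:M \in unitmx.
Proof.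
move=> lam0 A0; rewrite -row_free_unit -kermx_eq0; apply/rowV0P => x /sub_kermxP xA.
apply/eqP; apply: contraTT (ltW lam0) => /mul_rV_tr_gt0 xx; rewrite -ltNge.
have /matrixP/(_ 0 0) : x *m (A + lam%:M) *m x^T = 0 by rewrite xA mul0mx.
rewrite mulmxDr mulmxDl mul_mx_scalar -scalemxAl [RHS]mxE.
have -> (M N : 'M[R]_1) : (M + lam *: N) 0 0 = M 0 0 + lam * N 0 0 by rewrite !mxE.
move=> /eqP; rewrite addr_eq0 => /eqP e; have := A0 x; rewrite e oppr_ge0.
by rewrite pmulr_lle0// => lam1; have := lt_le_trans lam0 lam1; rewrite ltxx.
Qed.

Lemma gram_psd (R : realType) m n (M : 'M[R]_(m, n)) : psd (M *m M^T).
Proof.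
move=> x; rewrite mulmxA -[_ *m x^T]mulmxA -trmx_mul mul_rV_trE.
by apply: sumr_ge0 => i _; rewrite -expr2 sqr_ge0.
Qed.

Lemma invmx_eqr (F : fieldType) n (A B : 'M[F]_n) : A *m B = 1%:M -> invmx A = B.
Proof.
by move=> AB; have [uA _] := mulmx1_unit AB; rewrite -[RHS](mulKmx uA) AB mulmx1.
Qed.

(** Stated over any field and with an arbitrary inverse pair [P], [Q], so that it serves both the
    unitary diagonalization over [R[i]] behind [sd] and the real orthogonal one. *)
Lemma ridge_trace_diag (F : fieldType) n (P Q : 'M[F]_n) (mu : 'rV[F]_n) (lam : F) :
  P *m Q = 1%:M -> (forall i, mu 0 i + lam != 0) ->
  \tr (P *m diag_mx mu *m Q *m invmx (P *m diag_mx mu *m Q + lam%:M)) =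
  \sum_i mu 0 i / (mu 0 i + lam).
Proof.
move=> PQ mu0; have QP : Q *m P = 1%:M by exact: mulmx1C.
pose nu : 'rV[F]_n := \row_i (mu 0 i + lam)^-1.
have -> : invmx (P *m diag_mx mu *m Q + lam%:M) = P *m diag_mx nu *m Q.
  apply: invmx_eqr.
  have -> : P *m diag_mx mu *m Q + lam%:M = P *m diag_mx (mu + const_mx lam) *m Q.
    rewrite raddfD /= diag_const_mx mulmxDr mulmxDl; congr (_ + _).
    by rewrite mul_mx_scalar -scalemxAl PQ scalemx1.
  rewrite !mulmxA -[_ *m Q *m P]mulmxA QP mulmx1 -[_ *m _ *m diag_mx nu]mulmxA.
  rewrite mulmx_diag; set D := \row_j _.
  have -> : D = const_mx 1 by apply/rowP => i; rewrite !mxE divff.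
  by rewrite diag_const_mx mulmx1.
rewrite !mulmxA -[_ *m Q *m P]mulmxA QP mulmx1 mxtrace_mulC !mulmxA QP mul1mx.
by rewrite mulmx_diag mxtrace_diag; apply: eq_bigr => i _; rewrite !mxE.
Qed.

(** Zero singular values contribute [0] to [s^2 / (s^2 + lam)], so the sum may run over all indices;
    it is then the trace read off the diagonalized Gram matrix. *)
Lemma sd_trace (R : realType) (lam : R) m n (M : 'M[R]_(m, n)) : 0 < lam ->
  sd lam M = \tr (M *m M^T *m invmx (M *m M^T + lam%:M)).
Proof.
move=> lam0.
have den i : 0 < singular_value M i ^+ 2 + lam by rewrite ltr_wpDl ?sqr_ge0.
transitivity (\sum_i singular_value M i ^+ 2 / (singular_value M i ^+ 2 + lam)).
  rewrite /sd big_mkcond /=; apply: eq_bigr => i _; case: eqP => [->|/eqP s0] /=.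
    by rewrite expr0n mul0r.
  have := den i; move: (singular_value M i) s0 => s s0 den'; field.
  by rewrite lt0r_neq0.
apply: (@fmorph_inj _ _ (real_complex R)); rewrite rmorph_sum /=.
have -> (X : 'M[R]_m) : real_complex R (\tr X) = \tr (map_mx (real_complex R) X).
  by rewrite /mxtrace rmorph_sum; apply: eq_bigr => i _; rewrite mxE.
rewrite map_mxM map_invmx map_mxD map_scalar_mx /=.
rewrite [in RHS](orthomx_spectralP (gram_normal M)).
rewrite ridge_trace_diag; first last.
- move=> i; rewrite gram_spectral -rmorphD fmorph_eq0; exact: lt0r_neq0.
- by rewrite mulVmx// spectral_unit.
by apply: eq_bigr => i _; rewrite gram_spectral -rmorphD -fmorphV -rmorphM.
Qed.

Lemma invmx_sym (F : fieldType) n (A : 'M[F]_n) : A^T = A -> (invmx A)^T = invmx A.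
Proof. by move=> AT; rewrite trmx_inv AT. Qed.

Lemma mul_rV_trC (R : realType) n (x y : 'rV[R]_n) : (x *m y^T) 0 0 = (y *m x^T) 0 0.
Proof. by rewrite !mul_rV_trE; apply: eq_bigr => i _; rewrite mulrC. Qed.

(** With [y = b X^-1] and [y' = b Z^-1], the nonnegative numbers [(y - y') Z (y - y')^T] and
    [y (X - Z) y^T] add up to exactly the difference of the two sides. *)
Lemma invmx_antitone (R : realType) n (Z X : 'M[R]_n) :
  Z^T = Z -> X^T = X -> Z \in unitmx -> X \in unitmx -> psd Z -> psd (X - Z) ->
  forall b : 'rV[R]_n, (b *m invmx X *m b^T) 0 0 <= (b *m invmx Z *m b^T) 0 0.
Proof.
move=> ZT XT uZ uX Z0 XZ b; pose y := b *m invmx X; pose y' := b *m invmx Z.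
have yX : y *m X = b by rewrite mulmxKV.
have yZ : y' *m Z = b by rewrite mulmxKV.
have Zy : Z *m y'^T = b^T by rewrite -{1}ZT -trmx_mul yZ.
rewrite -/y -/y'; have := XZ y; have := Z0 (y - y').
rewrite [(y - y')^T]raddfB /= !mulmxBr !mulmxBl yX yZ -[y *m Z *m y'^T]mulmxA Zy.
have sub00 (M N : 'M[R]_1) : (M - N) 0 0 = M 0 0 - N 0 0 by rewrite !mxE.
rewrite !sub00 [(b *m y^T) 0 0]mul_rV_trC [(b *m y'^T) 0 0]mul_rV_trC.
by rewrite !opprB; lra.
Qed.

(** * Determinants of low-rank updates and a spanning family of rows with bounded coefficients *)

Lemma det_1addC (F : fieldType) m n (A : 'M[F]_(m, n)) (B : 'M[F]_(n, m)) :
  \det (1%:M + A *m B) = \det (1%:M + B *m A).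
Proof.
(* The same block matrix is factored into triangular ones in both orders. *)
have e1 : block_mx 1%:M (- A) B 1%:M =
    block_mx 1%:M 0 B 1%:M *m block_mx 1%:M (- A) 0 (1%:M + B *m A).
  rewrite mulmx_block !(mul1mx, mulmx1, mul0mx, mulmx0, addr0) mulmxN.
  by rewrite addrCA addNr addr0.
have e2 : block_mx 1%:M (- A) B 1%:M =
    block_mx (1%:M + A *m B) (- A) 0 1%:M *m block_mx 1%:M 0 B 1%:M.
  rewrite mulmx_block !(mul1mx, mulmx1, mul0mx, mulmx0, add0r) mulNmx.
  by rewrite addrK.
have := congr1 determinant e1; rewrite {1}e2 !det_mulmx.
by rewrite !det_lblock !det_ublock !det1 !mul1r !mulr1.
Qed.

Lemma det_block_scalar (F : fieldType) (a b c d : F) : a != 0 ->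
  \det (block_mx a%:M b%:M c%:M d%:M : 'M[F]_(1 + 1)) = a * d - b * c.
Proof.
move=> a0.
have -> : block_mx a%:M b%:M c%:M d%:M =
    block_mx 1%:M 0 (c / a)%:M 1%:M *m
    block_mx a%:M b%:M 0 (d - c * b / a)%:M :> 'M[F]_(1 + 1).
  rewrite mulmx_block !(mul1mx, mul0mx, mulmx0, addr0) -!scalar_mxM -raddfD /=.
  by congr (block_mx _ _ _%:M _%:M); field.
by rewrite det_mulmx det_lblock det_ublock !det1 !mul1r !det_scalar1; field.
Qed.

(** Exchanging one row of a family for another changes its Gram matrix by [c^T c - x^T x], a
    rank-two update whose determinant reduces to a 2 by 2 one; [1 + q c c] is the pivot there. *)
Lemma det_swap (F : fieldType) r (M : 'M[F]_r) (c x : 'rV[F]_r)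
    (q := fun u v : 'rV[F]_r => (u *m invmx M *m v^T) 0 0) :
  M \in unitmx -> 1 + q c c != 0 ->
  \det (M + c^T *m c - x^T *m x) =
  \det M * ((1 + q c c) * (1 - q x x) + q c x * q x c).
Proof.
move=> uM q0; pose G := invmx M.
have -> : M + c^T *m c - x^T *m x =
    M *m (1%:M + (G *m row_mx c^T (- x^T)) *m col_mx c x).
  rewrite mulmxDr mulmx1 !mulmxA mulmxV// mul1mx mul_row_col mulNmx.
  by rewrite addrA.
rewrite det_mulmx det_1addC; congr (_ * _).
rewrite mulmxA mul_col_mx mul_col_row scalar_mx_block add_block_mx !add0r !mulmxN.
have qE u v : u *m G *m v^T = (q u v)%:M by rewrite [LHS]mx11_scalar.
rewrite !qE -!raddfN -!raddfD /= det_block_scalar//.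
by rewrite mulNr opprK.
Qed.

Lemma mul_tr_rows (R : realType) m n (X : 'M[R]_(m, n)) :
  X^T *m X = \sum_j (row j X)^T *m row j X.
Proof.
apply/matrixP => a b; rewrite summxE mxE; apply: eq_bigr => j _.
by rewrite !mxE big_ord1 !mxE.
Qed.

(* The chosen rows maximize the Gram determinant over all families of [r + r]
   rows; averaging the inequality "no single swap increases it" over the chosen
   rows bounds the leverage of every row by [r / (r + 1)]. *)
Lemma row_full_spanner (R : realType) n r (C : 'M[R]_(n, r)) : row_full C ->
  exists f : 'I_(r + r) -> 'I_n, exists Y : 'M[R]_(n, r + r),
    C = Y *m rowsub f C /\ forall i, (row i Y *m (row i Y)^T) 0 0 <= 1.
Proof.
move=> fC.
pose Gram (f : {ffun 'I_(r + r) -> 'I_n}) := (rowsub f C)^T *m rowsub f C.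
(* A row basis of [C] taken twice has positive Gram determinant, so the maximal Gram matrix is
   invertible. *)
pose f0 : {ffun 'I_(r + r) -> 'I_n} :=
  [ffun j => match fintype.split j with inl a | inr a => fullrankfun fC a end].
have f0_gt0 : 0 < \det (Gram f0).
  have uY := fullrowsub_unit fC; set Y := rowsub _ C in uY.
  have -> : Gram f0 = 2 *: (Y^T *m Y).
    have -> : Gram f0 = (col_mx Y Y)^T *m col_mx Y Y.
      suff e : rowsub f0 C = col_mx Y Y by rewrite /Gram e.
      by apply/matrixP => a b; rewrite !mxE ffunE; case: fintype.split => j; rewrite mxE.
    by rewrite tr_col_mx mul_row_col scaler_nat mulr2n.
  rewrite detZ det_mulmx det_tr -expr2; apply: mulr_gt0; first by rewrite exprn_gt0.
  by rewrite lt_neqAle sqr_ge0 eq_sym sqrf_eq0 andbT -unitfE -unitmxE.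
have [f _ fmax] := @arg_maxP _ _ _ f0 predT (fun f => \det (Gram f)) isT.
have M_gt0 : 0 < \det (Gram f) by apply: lt_le_trans f0_gt0 (fmax _ isT).
set M := Gram f in fmax M_gt0; pose X := rowsub f C.
have ME : X^T *m X = M by [].
have uM : M \in unitmx by rewrite unitmxE unitfE lt0r_neq0.
have MT : M^T = M by rewrite trmx_mul trmxK.
pose G := invmx M; have GT : G^T = G by exact: invmx_sym.
(* These are the least-squares coefficients; the square norm of row [i] is the leverage
   [h = c G c^T]. *)
exists f, (C *m G *m X^T); split.
  by rewrite -!mulmxA ME mulVmx// mulmx1.
move=> i; rewrite !row_mul; set c := row i C.
pose h := (c *m G *m c^T) 0 0; set y := c *m G *m X^T.
have yy : (y *m y^T) 0 0 = h.
  rewrite /y trmx_mul trmxK trmx_mul GT !mulmxA -[c *m G *m X^T *m X]mulmxA ME.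
  by rewrite -[c *m G *m M]mulmxA mulVmx// mulmx1.
have h0 : 0 <= h by rewrite -yy mul_rV_trE sumr_ge0// => j _; rewrite -expr2 sqr_ge0.
have swap l : (1 + h) * (1 - (row l X *m G *m (row l X)^T) 0 0) + y 0 l ^+ 2 <= 1.
  pose g : {ffun 'I_(r + r) -> 'I_n} := [ffun j => if j == l then i else f j].
  have gE : Gram g = M + c^T *m c - (row l X)^T *m row l X.
    rewrite /X /M /Gram (mul_tr_rows (rowsub g C)) (mul_tr_rows (rowsub f C)).
    rewrite (bigD1 l)//= [in RHS](bigD1 l)//=.
    rewrite !row_rowsub ffunE eqxx -/c [RHS]addrAC [X in X - _]addrC addrK addrC.
    by congr (_ + _); apply: eq_bigr => j /negPf jl; rewrite !row_rowsub ffunE jl.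
  have : \det (Gram g) <= \det M := fmax g isT.
  rewrite gE det_swap//; last by rewrite gt_eqF// ltr_wpDr.
  rewrite ger_pMr// => /(le_trans _); apply; rewrite -/G -/h lerD2l.
  have yl : (c *m G *m (row l X)^T) 0 0 = y 0 l.
    by rewrite /y [LHS]mxE [RHS]mxE; apply: eq_bigr => j _; rewrite !mxE.
  have -> : (row l X *m G *m c^T) 0 0 = y 0 l.
    by rewrite -yl -mulmxA -GT -trmx_mul mul_rV_trC GT.
  by rewrite yl expr2.
(* The leverages of the chosen rows sum to the trace of the projection [X G X^T], which is its rank
   [r]. *)
have lev : \sum_l (row l X *m G *m (row l X)^T) 0 0 = r%:R.
  transitivity (\tr (X *m G *m X^T)).
    by apply: eq_bigr => l _; rewrite -row_mul [LHS]mxE [RHS]mxE;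
      apply: eq_bigr => j _; rewrite !mxE.
  by rewrite -mulmxA mxtrace_mulC -mulmxA ME mulVmx// mxtrace1.
have : \sum_l ((1 + h) * (1 - (row l X *m G *m (row l X)^T) 0 0) + y 0 l ^+ 2)
    <= \sum_(l < r + r) 1 by apply: ler_sum => l _.
rewrite big_split /= -mulr_sumr sumrB lev !sumr_const card_ord.
have -> : \sum_l y 0 l ^+ 2 = h.
  by rewrite -yy mul_rV_trE; apply: eq_bigr => l _; rewrite expr2.
(* The summed inequality reads [(1 + h) (2r - r) + h <= 2r], that is [h (r + 1) <= r]. *)
rewrite yy natrD; have : 0 <= r%:R :> R by [].
by move: (r%:R : R) => rr; nra.
Qed.

(** In the factorization [W = col_base W *m row_base W], selecting and combining rows acts on the
    left factor only, which has full column rank. *)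
Lemma row_spanner (R : realType) n d (W : 'M[R]_(n, d)) (r := \rank W) :
  exists f : 'I_(r + r) -> 'I_n, exists Y : 'M[R]_(n, r + r),
    W = Y *m rowsub f W /\ forall i, (row i Y *m (row i Y)^T) 0 0 <= 1.
Proof.
have [f [Y [CE Y1]]] := row_full_spanner (col_base_full W).
exists f, Y; split => //.
by rewrite -{2}(mulmx_base W) -mul_rowsub_mx mulmxA -CE mulmx_base.
Qed.

(** * Frobenius norms as traces and truncation of the spectrum *)

Lemma frobenius_tr (R : realType) m n (M : 'M[R]_(m, n)) :
  frobenius M ^+ 2 = \tr (M *m M^T).
Proof.
rewrite frobenius_sqr; apply: eq_bigr => i _; rewrite mxE; apply: eq_bigr => j _.
by rewrite mxE expr2.
Qed.

Lemma mxtrace_mul_diag (R : realType) m n (M : 'M[R]_(m, n)) (v : 'rV[R]_n) :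
  \tr (M *m diag_mx v *m M^T) = \sum_i \sum_j M i j ^+ 2 * v 0 j.
Proof.
apply: eq_bigr => i _; rewrite mxE; apply: eq_bigr => j _.
by rewrite mul_mx_diag !mxE; ring.
Qed.

(** The rows of [Y] are orthonormal eigenvectors for the eigenvalues above [theta]. Each of these
    adds at least [theta / (theta + lam)] to the trace, as [t / (t + lam)] increases with [t]; on
    the range of [P] the eigenvalues are at most [theta]. *)
Lemma spectral_truncation (R : realType) k (Psi : 'M[R]_k) (lam theta : R) :
  0 < lam -> 0 <= theta -> Psi^T = Psi -> psd Psi ->
  exists q, exists Y : 'M[R]_(q, k),
    [/\ Y *m Y^T = 1%:M,
        q%:R * (theta / (theta + lam)) <= \tr (Psi *m invmx (Psi + lam%:M)) &
        let P := 1%:M - Y^T *m Y in forall n (U : 'M[R]_(n, k)),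
          \tr (U *m P *m Psi *m (U *m P)^T) <= theta * frobenius U ^+ 2].
Proof.
move=> lam0 theta0 PsiT Psi0; have [Q [mu [QQ PsiE]]] := symmetric_spectral PsiT.
have QtQ : Q^T *m Q = 1%:M by exact: mulmx1C.
have mu0 j : 0 <= mu 0 j.
  have rQ : row j Q *m Q^T = delta_mx 0 j by rewrite rowE -mulmxA QQ mulmx1.
  have := Psi0 (row j Q); rewrite PsiE !mulmxA rQ -[_ *m Q *m _]mulmxA.
  have -> : Q *m (row j Q)^T = (delta_mx 0 j)^T.
    by rewrite -[LHS]trmxK trmx_mul trmxK rQ.
  rewrite mul_mx_diag trmx_delta mxE (bigD1 j)//=.
  rewrite big1 ?addr0 => [|i /negPf ij]; last by rewrite !mxE ij mulr0.
  by rewrite !mxE !eqxx mulr1 mul1r.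
pose J := [pred j : 'I_k | theta < mu 0 j].
pose chi : 'rV[R]_k := \row_j (~~ J j)%:R.
pose Y := rowsub (fun a : 'I_#|J| => enum_val a) Q.
have PE : 1%:M - Y^T *m Y = Q^T *m diag_mx chi *m Q.
  have eJ (F : 'I_k -> 'M[R]_k) : \sum_(a < #|J|) F (enum_val a) = \sum_(j | J j) F j.
    by rewrite -(big_enum_val F).
  apply/eqP; rewrite subr_eq; apply/eqP; rewrite -{1}QtQ mul_tr_rows.
  rewrite (mul_tr_rows Y); under [X in _ = _ + X]eq_bigr do rewrite row_rowsub.
  rewrite (eJ (fun j => (row j Q)^T *m row j Q)) (bigID J) /= addrC; congr (_ + _).
  rewrite big_mkcond /=; apply/matrixP => a b; rewrite summxE [RHS]mxE.
  apply: eq_bigr => j _; rewrite mul_mx_diag !mxE /=.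
  by case: ifP => _; rewrite !mxE ?big_ord1 ?mxE ?mulr1 ?mulr0 ?mul0r.
exists #|J|, Y; split.
- apply/matrixP => a b.
  have /matrixP/(_ (enum_val a) (enum_val b)) := QQ.
  rewrite !mxE (inj_eq enum_val_inj) => <-; apply: eq_bigr => j _.
  by rewrite !mxE.
- rewrite PsiE ridge_trace_diag//; last first.
    by move=> j; rewrite lt0r_neq0// ltr_wpDl.
  rewrite -sum1_card natr_sum mulr_suml big_mkcond /=; apply: ler_sum => j _.
  have ml : 0 < mu 0 j + lam by rewrite ltr_wpDl.
  case: ifP => [|_]; last by rewrite divr_ge0// ltW.
  rewrite inE => /ltW tj; rewrite mul1r ler_pdivrMr ?ltr_wpDl// mulrAC.
  by rewrite ler_pdivlMr//; nra.
- move=> P n U; rewrite /P PE PsiE !trmx_mul trmxK tr_diag_mx !mulmxA.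
  rewrite -[_ *m Q *m Q^T]mulmxA QQ mulmx1 -[_ *m Q *m Q^T]mulmxA QQ mulmx1.
  have -> : U *m Q^T *m diag_mx chi *m diag_mx mu *m diag_mx chi *m Q *m U^T =
      (U *m Q^T) *m diag_mx (\row_j (chi 0 j ^+ 2 * mu 0 j)) *m (U *m Q^T)^T.
    rewrite trmx_mul trmxK !mulmxA -[_ *m diag_mx mu]mulmxA -[_ *m diag_mx chi]mulmxA.
    rewrite !mulmx_diag; congr (_ *m diag_mx _ *m _ *m _).
    by apply/rowP => j; rewrite !mxE; ring.
  have -> : frobenius U ^+ 2 = frobenius (U *m Q^T) ^+ 2.
    by rewrite !frobenius_tr trmx_mul trmxK mulmxA -[_ *m Q^T *m Q]mulmxA QtQ mulmx1.
  rewrite mxtrace_mul_diag frobenius_sqr mulr_sumr; apply: ler_sum => i _.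
  rewrite mulr_sumr; apply: ler_sum => j _; rewrite mulrC ler_wpM2r ?sqr_ge0// !mxE.
  by case: (boolP (J j)) => /= Jj; rewrite ?expr0n ?expr1n ?mul0r ?mul1r// leNgt.
Qed.

(** * First-order conditions at a minimizer and the loss after truncation *)

Lemma quadratic_linear_coef0 (R : realType) (b c : R) :
  (forall t, 0 <= t ^+ 2 * c - 2 * t * b) -> b = 0.
Proof.
(* At [t = b / D] the quadratic equals [t^2 (c - 2D)], and [c - 2D < 0]; so a nonzero [b] would make
   it negative. *)
move=> h; apply/eqP/negP => /negP b0; pose D := `|c| + 1.
have D0 : 0 < D by rewrite ltr_wpDl.
have cD : c <= D by rewrite ler_wpDr// ler_norm.
have := h (b / D); apply/negP; rewrite -ltNge.
have -> : (b / D) ^+ 2 * c - 2 * (b / D) * b = (b / D) ^+ 2 * (c - 2 * D).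
  by field; exact: lt0r_neq0.
rewrite pmulr_rlt0; first by lra.
by rewrite exprn_even_gt0//= mulf_neq0// invr_neq0// lt0r_neq0.
Qed.

Lemma frobenius_subZ (R : realType) m n (M N : 'M[R]_(m, n)) (t : R) :
  frobenius (M - t *: N) ^+ 2 =
  frobenius M ^+ 2 - 2 * t * \tr (M *m N^T) + t ^+ 2 * frobenius N ^+ 2.
Proof.
rewrite !frobenius_sqr /mxtrace !mulr_sumr -sumrB -big_split /=.
apply: eq_bigr => i _; rewrite mxE !mulr_sumr -sumrB -big_split /=.
by apply: eq_bigr => j _; rewrite !mxE; ring.
Qed.

Lemma hadamard_subZ (R : realType) n d (W M N : 'M[R]_(n, d)) (t : R) :
  hadamard W (M - t *: N) = hadamard W M - t *: hadamard W N.
Proof. by apply/matrixP => i j; rewrite !mxE; ring. Qed.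

(** Moving from [U] to [U - t H] changes the loss by a quadratic in [t] without constant term;
    minimality makes its linear coefficient vanish. *)
Lemma minimizer_stationary_l (R : realType) n d k (lam : R) (A W : 'M[R]_(n, d))
    (U H : 'M[R]_(n, k)) (V : 'M[R]_(k, d)) : minimizer lam A W U V ->
  \tr (hadamard W (U *m V - A) *m (hadamard W (H *m V))^T) =
  - (lam * \tr (U *m H^T)).
Proof.
move=> UV; set b1 := \tr _; set b2 := \tr (U *m H^T).
suff : b1 + lam * b2 = 0 by move/eqP; rewrite addr_eq0 => /eqP.
apply: (@quadratic_linear_coef0 R _
  (frobenius (hadamard W (H *m V)) ^+ 2 + lam * frobenius H ^+ 2)) => t.
have := UV (U - t *: H) V; rewrite /loss mulmxBl -scalemxAl.
rewrite [_ - _ - A]addrAC hadamard_subZ !frobenius_subZ -/b1 -/b2.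
by rewrite -subr_ge0 => /le_trans; apply; rewrite le_eqVlt; apply/orP; left;
  apply/eqP; ring.
Qed.

Lemma minimizer_stationary_r (R : realType) n d k (lam : R) (A W : 'M[R]_(n, d))
    (U : 'M[R]_(n, k)) (V H : 'M[R]_(k, d)) : minimizer lam A W U V ->
  \tr (hadamard W (U *m V - A) *m (hadamard W (U *m H))^T) =
  - (lam * \tr (V *m H^T)).
Proof.
move=> UV; set b1 := \tr _; set b2 := \tr (V *m H^T).
suff : b1 + lam * b2 = 0 by move/eqP; rewrite addr_eq0 => /eqP.
apply: (@quadratic_linear_coef0 R _
  (frobenius (hadamard W (U *m H)) ^+ 2 + lam * frobenius H ^+ 2)) => t.
have := UV U (V - t *: H); rewrite /loss mulmxBr -scalemxAr.
rewrite [_ - _ - A]addrAC hadamard_subZ !frobenius_subZ -/b1 -/b2.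
by rewrite -subr_ge0 => /le_trans; apply; rewrite le_eqVlt; apply/orP; left;
  apply/eqP; ring.
Qed.

(* At a stationary point the two regularizers change by the same amount, which
   exactly compensates the first-order change of the fit. *)
Lemma loss_truncate (R : realType) n d k q (lam : R) (A W : 'M[R]_(n, d))
    (U : 'M[R]_(n, k)) (V : 'M[R]_(k, d)) (Y : 'M[R]_(q, k))
    (P := 1%:M - Y^T *m Y) :
  minimizer lam A W U V -> Y *m Y^T = 1%:M ->
  loss lam A W (U *m Y^T) (Y *m V) =
  loss lam A W U V + frobenius (hadamard W (U *m P *m V)) ^+ 2.
Proof.
move=> UV YY; have PT : P^T = P by rewrite /P raddfB /= trmx1 trmx_mul trmxK.
have PP : P *m P = P.
  rewrite {1}/P mulmxBl mul1mx /P mulmxBr mulmx1 mulmxA -[_ *m Y *m Y^T]mulmxA YY.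
  by rewrite mulmx1 subrr subr0.
have YYP : Y^T *m Y = 1%:M - P by rewrite /P opprB addrC subrK.
(* Both directions perturb the product by the same matrix [U P V], so the two conditions share their
   left side and [lam ||U P||^2 = lam ||P V||^2]. *)
have hl := minimizer_stationary_l (U *m P) UV.
have hr := minimizer_stationary_r (P *m V) UV.
have UP : \tr (U *m (U *m P)^T) = frobenius (U *m P) ^+ 2.
  by rewrite frobenius_tr !trmx_mul PT !mulmxA -[_ *m P *m P]mulmxA PP.
have VP : \tr (V *m (P *m V)^T) = frobenius (P *m V) ^+ 2.
  rewrite frobenius_tr trmx_mul PT [LHS]mxtrace_mulC [RHS]mxtrace_mulC -!mulmxA.
  by rewrite [P *m (P *m V)]mulmxA PP.
have eU : frobenius (U *m Y^T) ^+ 2 = frobenius U ^+ 2 - frobenius (U *m P) ^+ 2.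
  rewrite -UP !frobenius_tr !trmx_mul trmxK PT mulmxA -[_ *m Y^T *m Y]mulmxA YYP.
  by rewrite mulmxBr mulmx1 mulmxBl raddfB /= mulmxA.
have eV : frobenius (Y *m V) ^+ 2 = frobenius V ^+ 2 - frobenius (P *m V) ^+ 2.
  rewrite -VP !frobenius_tr !trmx_mul PT mulmxA mxtrace_mulC !mulmxA YYP.
  rewrite mulmxBl mul1mx mulmxBl raddfB /=; congr (_ - _).
  by rewrite -mulmxA mxtrace_mulC.
have eF : U *m Y^T *m (Y *m V) - A = U *m V - A - 1 *: (U *m P *m V).
  rewrite scale1r mulmxA -[_ *m Y^T *m Y]mulmxA YYP mulmxBr mulmx1 mulmxBl.
  by rewrite addrAC.
rewrite /loss eF hadamard_subZ frobenius_subZ eU eV.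
move: hl hr; rewrite UP VP mulmxA => -> /eqP; rewrite eqr_opp => /eqP e.
by rewrite !mulrBr -e; ring.
Qed.

(** * Comparison of ranks, and bounds for the final estimate *)

Lemma OPT_le_loss (R : realType) n d q m (lam : R) (A W : 'M[R]_(n, d))
    (U : 'M[R]_(n, q)) (V : 'M[R]_(q, d)) : 0 < lam -> (q <= m)%N ->
  OPT lam A W m <= loss lam A W U V.
Proof.
move=> lam0 qm; rewrite -(subnKC qm); move: (m - q)%N => p {m qm}.
(* Padding the factors with zero columns and zero rows changes neither the product nor the norms. *)
have -> : loss lam A W U V = loss lam A W (row_mx U (0 : 'M[R]_(n, p))) (col_mx V 0).
  rewrite /loss mul_row_col mul0mx addr0; congr (_ + _ * _ + _ * _).
    by rewrite !frobenius_tr tr_row_mx mul_row_col trmx0 mulmx0 addr0.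
  rewrite !frobenius_sqr big_split_ord /= [X in _ + X]big1 ?addr0.
    by apply: eq_bigr => i _; apply: eq_bigr => j _; rewrite col_mxEu.
  by move=> i _; apply: big1 => j _; rewrite col_mxEd mxE expr0n.
apply: ge_inf; last by exists (row_mx U 0, col_mx V 0).
exists 0 => _ [[U' V'] _ <-]; rewrite /loss.
by apply: addr_ge0; [apply: addr_ge0|]; rewrite ?sqr_ge0// mulr_ge0 ?sqr_ge0// ltW.
Qed.

Lemma sqr_sum_mul_le (R : realType) (I : finType) (a b : I -> R) :
  \sum_i a i ^+ 2 <= 1 -> (\sum_i a i * b i) ^+ 2 <= \sum_i b i ^+ 2.
Proof.
move=> a1; set S := \sum_i _ * _.
(* Expanded, this gives [S^2 (2 - sum a^2) <= sum b^2], where [2 - sum a^2 >= 1]. *)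
have : 0 <= \sum_i (b i - S * a i) ^+ 2 by apply: sumr_ge0 => i _; rewrite sqr_ge0.
have -> : \sum_i (b i - S * a i) ^+ 2 =
    \sum_i b i ^+ 2 - 2 * S * S + S ^+ 2 * \sum_i a i ^+ 2.
  have -> : 2 * S * S = \sum_i 2 * S * (a i * b i) by rewrite -mulr_sumr.
  rewrite mulr_sumr -sumrB -big_split /=.
  by apply: eq_bigr => i _; ring.
by have := sqr_ge0 S; nra.
Qed.

Lemma nat_le_absz_ceil (R : realType) (q : nat) (x : R) :
  q%:R <= x -> (q <= `|Num.ceil x|%N)%N.
Proof.
move=> qx; have c0 : 0 <= Num.ceil x.
  by rewrite ceil_ge0 (lt_le_trans _ qx)// (lt_le_trans (ltrN10 R)).
rewrite -lez_nat gez0_abs// -(ler_int R); apply: (le_trans qx); exact: ceil_ge.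
Qed.

(** The termwise half of the subadditivity of [M |-> tr (M (M + lam)^-1)]: the trace splits over the
    columns of [B], and enlarging [B B^T] to [Psi] only decreases the inverse. *)
Lemma tr_mul_invmx_le_sd (R : realType) m n (lam : R) (B : 'M[R]_(m, n))
    (Psi : 'M[R]_m) : 0 < lam -> Psi^T = Psi -> psd (Psi - B *m B^T) ->
  \tr (B *m B^T *m invmx (Psi + lam%:M)) <= sd lam B.
Proof.
move=> lam0 PsiT PsiB; rewrite sd_trace//.
have BB := gram_psd B.
have Psi0 : psd Psi.
  move=> x; have := PsiB x; rewrite mulmxBr mulmxBl => h.
  have := addr_ge0 h (BB x).
  by have -> (M N : 'M[R]_1) : (M - N) 0 0 + N 0 0 = M 0 0 by rewrite !mxE subrK.
have trE (Z : 'M[R]_m) : \tr (B *m B^T *m Z) =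
    \sum_j (row j B^T *m Z *m (row j B^T)^T) 0 0.
  rewrite -mulmxA mxtrace_mulC /mxtrace.
  apply: eq_bigr => j _; rewrite -row_mul [LHS]mxE [RHS]mxE.
  by apply: eq_bigr => i _; rewrite !mxE.
rewrite !trE; apply: ler_sum => j _; apply: invmx_antitone.
- by rewrite raddfD /= tr_scalar_mx trmx_mul trmxK.
- by rewrite raddfD /= tr_scalar_mx PsiT.
- exact: psd_shift_unit.
- exact: psd_shift_unit.
- move=> x; rewrite mulmxDr mulmxDl mul_mx_scalar -scalemxAl.
  have -> (M N : 'M[R]_1) : (M + lam *: N) 0 0 = M 0 0 + lam * N 0 0 by rewrite !mxE.
  apply: addr_ge0; first exact: BB.
  apply: mulr_ge0; first exact: ltW.
  by rewrite mul_rV_trE; apply: sumr_ge0 => i _; rewrite -expr2 sqr_ge0.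
- by rewrite opprD addrACA subrr addr0.
Qed.

(** * Truncating the minimizer: rank bound and loss bound *)

Theorem theorem4 (R : realType) :
  exists C : R, 0 < C /\
  forall (n d k r : nat) (lam eps s : R) (A W : 'M[R]_(n, d))
    (Ustar : 'M[R]_(n, k)) (Vstar : 'M[R]_(k, d)),
    0 < lam -> (0 < k)%N -> 0 < eps -> eps < 1 / 10 ->
    \rank W = r ->
    minimizer lam A W Ustar Vstar ->
    s = max_sd lam W Ustar Vstar ->
    s < k%:R ->
    OPT lam A W `|Num.ceil (C * (r%:R * (s + ln (1 / eps)) / eps))|%N
      <= (1 + eps) * OPT lam A W k.
Proof.
(* The truncation has rank at most [2rs (1 + eps) / eps], and [2 (1 + eps) < 3] because
   [eps < 1/10]. *)
exists 3; split=> // n d k r lam eps s A W U V lam0 _ eps0 eps1 <- UV sE _.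
have OPTk : loss lam A W U V <= OPT lam A W k.
  by have [U' [V' [_ ->]]] := OPT_attained A W k lam0; exact: UV.
have [f [Y [WE Y1]]] := row_spanner W.
pose B l := V *m diag_mx (row (f l) W).
pose Psi := \sum_l B l *m (B l)^T.
have PsiT : Psi^T = Psi.
  by rewrite raddf_sum /=; apply: eq_bigr => l _; rewrite trmx_mul trmxK.
have psd_sum (P : pred 'I_(\rank W + \rank W)) : psd (\sum_(l | P l) B l *m (B l)^T).
  move=> x; rewrite mulmx_sumr mulmx_suml summxE; apply: sumr_ge0 => l _.
  exact: gram_psd.
(* The threshold [eps * lam] lets the regularizer [lam ||U||^2] pay for the discarded eigenvalues at
   rate [eps]. *)
have el0 : 0 <= eps * lam by rewrite mulr_ge0// ltW.
have [q [Q [QQ qle Qtr]]] := spectral_truncation lam0 el0 PsiT (psd_sum predT).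
have s_ge l : sd lam (B l) <= s.
  rewrite sE /max_sd le_max; apply/orP; left.
  exact: (le_bigmax _ (fun i => sd lam (V *m diag_mx (row i W)))).
have trs : \tr (Psi *m invmx (Psi + lam%:M)) <= (\rank W + \rank W)%:R * s.
  rewrite {1}/Psi mulmx_suml raddf_sum /= mulr_natl -[X in _ *+ X]card_ord -sumr_const.
  apply: ler_sum => l _; apply: le_trans (s_ge l); apply: tr_mul_invmx_le_sd => //.
  (* [Psi - B_l B_l^T] is the sum of the other Gram matrices. *)
  rewrite /Psi (bigD1 l)//= addrAC subrr add0r; exact: psd_sum.
have s0 : 0 <= s by rewrite sE /max_sd le_max bigmax_ge_id.
have ln0 : 0 <= ln (1 / eps).
  by rewrite ln_ge0// div1r -[leLHS]invr1 lef_pV2 ?posrE//; lra.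
apply: le_trans (_ : loss lam A W (U *m Q^T) (Q *m V) <= _).
  apply: OPT_le_loss => //; apply: nat_le_absz_ceil.
  have := le_trans qle trs.
  have -> : eps * lam / (eps * lam + lam) = eps / (1 + eps).
    by field; rewrite !lt0r_neq0//; nra.
  rewrite mulrA ler_pdivrMr; last by lra.
  rewrite natrD mulrA ler_pdivlMr// => /le_trans; apply.
  have : 0 <= (\rank W)%:R * s by rewrite mulr_ge0.
  have : 0 <= (\rank W)%:R * ln (1 / eps) by rewrite mulr_ge0.
  by nra.
rewrite loss_truncate//; set P := 1%:M - _.
apply: le_trans (_ : _ <= (1 + eps) * loss lam A W U V) _; last first.
  by rewrite ler_wpM2l//; lra.
rewrite mulrDl mul1r lerD2l.
apply: le_trans (_ : _ <= eps * lam * frobenius U ^+ 2) _; last first.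
  rewrite -mulrA; apply: ler_wpM2l; first exact: ltW.
  rewrite /loss -addrA addrCA lerDl.
  by apply: addr_ge0; rewrite ?sqr_ge0// mulr_ge0 ?sqr_ge0// ltW.
apply: le_trans (Qtr _ U); rewrite -/P.
(* Writing [Psi] as [V diag(w) V^T] turns the trace into a sum of the squared entries of [U P V]
   with column weights [w], so it suffices to show [W i b ^+ 2 <= w 0 b] for each entry. *)
pose w : 'rV[R]_d := \row_b \sum_l W (f l) b ^+ 2.
have -> : Psi = V *m diag_mx w *m V^T.
  have -> : diag_mx w = \sum_l diag_mx (row (f l) W) *m diag_mx (row (f l) W).
    apply/matrixP => a b; rewrite summxE [LHS]mxE [w 0 _]mxE -sumrMnl.
    by apply: eq_bigr => l _; rewrite mulmx_diag !mxE expr2.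
  rewrite mulmx_sumr mulmx_suml; apply: eq_bigr => l _.
  by rewrite trmx_mul tr_diag_mx !mulmxA.
rewrite [(U *m P)^T in leRHS]lock !mulmxA -lock -[_ *m V^T *m _]mulmxA -trmx_mul.
rewrite mxtrace_mul_diag frobenius_sqr; apply: ler_sum => i _; apply: ler_sum => b _.
rewrite [w 0 b]mxE [hadamard _ _ i b]mxE exprMn mulrC ler_wpM2l ?sqr_ge0//.
have -> : W i b = \sum_l Y i l * W (f l) b.
  by rewrite {1}WE mxE; apply: eq_bigr => l _; rewrite mxE.
apply: sqr_sum_mul_le; have := Y1 i; rewrite mul_rV_trE.
by under eq_bigr do rewrite mxE -expr2.
Qed.
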